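(* Assume that (A2) the Jacobian $JF$ is Lipschitz continuous with constant $L>0$ on an open set $\mathcal{B}$ containing $\mathcal{L}=\{x\in\mathbb{R}^n: F_i(x)\le F_i(x^0)\ \forall i\}$, i.e. $\|JF(x)-JF(y)\|\le L\|x-y\|$ for all $x,y\in\mathcal{B}$; and (A3) the set $\mathcal{L}$ is bounded. Let $\{(x^k,d^k)\}$ be an infinite sequence generated by MMG-I or by MMG-II (as described in the context) from the starting point $x^0$, with $v(x^k)\ne0$ for all $k$. Then $$\liminf_{k\to\infty}\|v(x^k)\|=0.$$
   Context: Let $F=(F_1,\dots,F_m)^\top:\mathbb{R}^n\to\mathbb{R}^m$ with every $F_i$ continuously differentiable, and let $JF(x)\in\mathbb{R}^{m\times n}$ be its Jacobian, with rows $\nabla F_i(x)^\top$. Vectors carry the Euclidean norm; a matrix $A\in\mathbb{R}^{m\times n}$ carries the norm $\|A\|=\max_{1\le i\le m}\|A_{i,\cdot}\|$ (maximum Euclidean norm of the rows). For $a,b\in\mathbb{R}^m$, $a\preceq b$ means $a_i\le b_i$ for all $i$; $e=(1,\dots,1)^\top\in\mathbb{R}^m$. Define $\psi(x,d)=\max_{1\le i\le m}\langle\nabla F_i(x),d\rangle$ and let $v(x)$ be the unique minimizer over $d\in\mathbb{R}^n$ of $\psi(x,d)+\frac12\|d\|^2$. For $\chi\in\mathbb{R}$ put $\chi^+=0$ if $\chi=0$ and $\chi^+=1/\chi$ otherwise. MMG scheme: given $x^0\in\mathbb{R}^n$, a positive integer $N$, parameters $\gamma_k>0$ ($k\ge0$)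 and $\beta_{kj}\in\mathbb{R}$ ($k\ge1$, $1\le j\le N_k$, where $N_k=\min\{k,N\}$), set $d^0=\gamma_0v(x^0)$, $d^k=\gamma_kv(x^k)+\sum_{j=1}^{N_k}\beta_{kj}d^{k-j}$ for $k\ge1$, and $x^{k+1}=x^k+\alpha_kd^k$ with a stepsize $\alpha_k>0$. Parameter conditions (P): there is a constant $\gamma^*>0$ with $\gamma_k\ge\gamma^*$ for all $k\ge0$, and for all $k\ge1$, $1\le j\le N_k$, $\beta_{kj}=-\frac1{N_k}\psi(x^k,v(x^k))\phi_{kj}^+$ with $\phi_{kj}>\frac{\psi(x^k,d^{k-j})+\|JF(x^k)\|\|d^{k-j}\|}{\gamma_k}$. MMG-I: the MMG scheme with parameters satisfying (P) and the Stepsize-I strategy: with fixed $\rho,\delta\in(0,1)$ and $\tau_k=-\psi(x^k,d^k)/\|d^k\|^2$, $\alpha_k$ is the largest element of $\{\tau_k,\delta\tau_k,\delta^2\tau_k,\dots\}$ satisfying $F(x^k+\alpha_kd^k)\preceq F(x^k)+\rho\alpha_k\psi(x^k,d^k)e$. MMG-II: the MMG scheme with parameters satisfying (P) and the Stepsize-II strategy: $\alpha_k=\frac{-\psi(x^k,d^k)}{2L\|d^k\|^2}$, where $L$ is the Lipschitz constant of $JF$ in (A2). *)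

(* Defs.v *)
From mathcomp Require Import all_boot all_order all_algebra.
From mathcomp Require Import all_classical all_reals all_analysis.
Import Order.TTheory GRing.Theory Num.Theory.
Import numFieldNormedType.Exports.

Set Implicit Arguments.
Unset Strict Implicit.
Unset Printing Implicit Defensive.

Local Open Scope classical_set_scope.
Local Open Scope ring_scope.

(* The library norm on matrices is the sup norm; the Euclidean norm is defined
   here.  Both induce the library topology, so [open], [continuous] and
   [differentiable] below are the usual notions on R^n. *)
Definition dotv (R : realType) (n : nat) (u w : 'rV[R]_n) : R :=
  \sum_i u ord0 i * w ord0 i.

Definition enorm (R : realType) (n : nat) (u : 'rV[R]_n) : R :=
  Num.sqrt (dotv u u).

(* Maximum of a nonempty finite family; seeding with [f ord0] instead of 0
   matters because the values may all be negative. *)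
Definition maxI (R : realType) (m : nat) (f : 'I_m.+1 -> R) : R :=
  \big[Num.max/f ord0]_(i < m.+1) f i.

Definition rownorm (R : realType) (m n : nat) (A : 'M[R]_(m.+1, n)) : R :=
  maxI (fun i => enorm (row i A)).

(* The library Jacobian acts on row vectors from the right; its transpose has
   the gradients of the components of F as rows. *)
Definition jac (R : realType) (n m : nat) (F : 'rV[R]_n -> 'rV[R]_m)
    (x : 'rV[R]_n) : 'M[R]_(m, n) :=
  ('J F x)^T.

Definition cont_diff (R : realType) (n m : nat) (F : 'rV[R]_n -> 'rV[R]_m) :
    Prop :=
  (forall x, differentiable F x) /\ continuous (jac F).

Definition psi (R : realType) (n m : nat) (F : 'rV[R]_n -> 'rV[R]_m.+1)
    (x d : 'rV[R]_n) : R :=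
  maxI (fun i => dotv (row i (jac F x)) d).

Definition steepest_obj (R : realType) (n m : nat)
    (F : 'rV[R]_n -> 'rV[R]_m.+1) (x d : 'rV[R]_n) : R :=
  psi F x d + enorm d ^+ 2 / 2.

(* The minimizer exists and is unique (the objective is strongly convex), so
   [get] returns it. *)
Definition vdir (R : realType) (n m : nat) (F : 'rV[R]_n -> 'rV[R]_m.+1)
    (x : 'rV[R]_n) : 'rV[R]_n :=
  get [set d | forall d', steepest_obj F x d <= steepest_obj F x d'].

Definition recip0 (R : realType) (chi : R) : R :=
  if chi == 0 then 0 else chi^-1.

Definition lev (R : realType) (n m : nat) (F : 'rV[R]_n -> 'rV[R]_m)
    (x0 : 'rV[R]_n) : set 'rV[R]_n :=
  [set x | forall i, F x ord0 i <= F x0 ord0 i].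

Definition jac_lipschitz_on (R : realType) (n m : nat)
    (F : 'rV[R]_n -> 'rV[R]_m.+1) (L : R) (B : set 'rV[R]_n) : Prop :=
  forall x y, B x -> B y -> rownorm (jac F x - jac F y) <= L * enorm (x - y).

Definition ebounded (R : realType) (n : nat) (A : set 'rV[R]_n) : Prop :=
  exists M : R, forall x, A x -> enorm x <= M.

Definition MMG_scheme (R : realType) (n m : nat)
    (F : 'rV[R]_n -> 'rV[R]_m.+1) (x0 : 'rV[R]_n) (N : nat)
    (gamma : nat -> R) (beta : nat -> nat -> R) (alpha : nat -> R)
    (x d : nat -> 'rV[R]_n) : Prop :=
  [/\ (0 < N)%N,
      forall k, 0 < gamma k,
      forall k, 0 < alpha k,
      x 0%N = x0 /\ (forall k, x k.+1 = x k + alpha k *: d k) &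
      d 0%N = gamma 0%N *: vdir F (x 0%N) /\
      (forall k, (1 <= k)%N ->
         d k = gamma k *: vdir F (x k) +
               \sum_(1 <= j < (minn k N).+1) beta k j *: d (k - j)%N)].

Definition MMG_params (R : realType) (n m : nat)
    (F : 'rV[R]_n -> 'rV[R]_m.+1) (N : nat)
    (gamma : nat -> R) (beta : nat -> nat -> R)
    (x d : nat -> 'rV[R]_n) : Prop :=
  (exists2 gstar : R, 0 < gstar & forall k, gstar <= gamma k) /\
  (exists phi : nat -> nat -> R,
     forall k j, (1 <= k)%N -> (1 <= j <= minn k N)%N ->
       beta k j =
         - ((minn k N)%:R^-1) * psi F (x k) (vdir F (x k)) * recip0 (phi k j)
       /\ (psi F (x k) (d (k - j)%N)
            + rownorm (jac F (x k)) * enorm (d (k - j)%N)) / gamma k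
          < phi k j).

Definition sufficient_decrease (R : realType) (n m : nat)
    (F : 'rV[R]_n -> 'rV[R]_m.+1) (rho : R) (x d : 'rV[R]_n) (a : R) : Prop :=
  forall i, F (x + a *: d) ord0 i <= F x ord0 i + rho * a * psi F x d.

Definition stepsize_I (R : realType) (n m : nat)
    (F : 'rV[R]_n -> 'rV[R]_m.+1) (rho delta : R) (x d : 'rV[R]_n) (a : R) :
    Prop :=
  let tau := - psi F x d / enorm d ^+ 2 in
  let S := [set b | (exists j : nat, b = delta ^+ j * tau) /\
                    sufficient_decrease F rho x d b] in
  S a /\ (forall b, S b -> b <= a).

Definition stepsize_II (R : realType) (n m : nat)
    (F : 'rV[R]_n -> 'rV[R]_m.+1) (L : R) (x d : 'rV[R]_n) (a : R) : Prop :=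
  a = - psi F x d / (2 * L * enorm d ^+ 2).

Definition MMG_I (R : realType) (n m : nat)
    (F : 'rV[R]_n -> 'rV[R]_m.+1) (x0 : 'rV[R]_n) (x d : nat -> 'rV[R]_n) :
    Prop :=
  exists (N : nat) (gamma : nat -> R) (beta : nat -> nat -> R)
         (alpha : nat -> R) (rho delta : R),
    [/\ MMG_scheme F x0 N gamma beta alpha x d,
        MMG_params F N gamma beta x d,
        0 < rho < 1, 0 < delta < 1 &
        forall k, stepsize_I F rho delta (x k) (d k) (alpha k)].

Definition MMG_II (R : realType) (n m : nat)
    (F : 'rV[R]_n -> 'rV[R]_m.+1) (L : R) (x0 : 'rV[R]_n)
    (x d : nat -> 'rV[R]_n) : Prop :=
  exists (N : nat) (gamma : nat -> R) (beta : nat -> nat -> R)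
         (alpha : nat -> R),
    [/\ MMG_scheme F x0 N gamma beta alpha x d,
        MMG_params F N gamma beta x d &
        forall k, stepsize_II F L (x k) (d k) (alpha k)].

(* Main.v *)
Require Import Defs.
From mathcomp Require Import all_boot all_order all_algebra.
From mathcomp Require Import all_classical all_reals all_analysis.
From mathcomp Require Import ring lra.
Import Order.TTheory GRing.Theory Num.Theory.
Import numFieldNormedType.Exports.
Local Open Scope classical_set_scope.
Local Open Scope ring_scope.

(** The argument is a Zoutendijk-type descent argument.  Write [v], [d] and
    [psi d] for the steepest descent direction, the search direction and the
    value of [psi] at the current iterate, and [J] for the Jacobian norm.

    Angle condition.  Comparing [v] with its multiples [t *: v] gives
    [psi v = - |v|^2] and hence [|v| <= J].  The lower bound on the [phi] makes
    the memory terms [p_j] enter with nonnegative weights [b_j]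
    for which [sum_j b_j (psi p_j + J |p_j|) <= gamma |v|^2].  Since [psi] is
    sublinear, this single inequality bounds [- psi d] from below both by
    [J sum_j b_j |p_j|] and by [gamma |v|^2 - J sum_j b_j |p_j|], so that
    [- psi d] dominates the two parts of [|d|] at once: [d] is a descent
    direction and [|v| |d| <= - 3 psi d] ([mmg_direction]).

    Stepsize.  Along a ray from a point of the level set, the mean value
    theorem and the Lipschitz bound give sufficient decrease for every step up
    to [(1 - rho) / L] times [- psi d / |d|^2] ([sufficient_decrease_short]).
    The backtracking stepsize is therefore at least a fixed multiple of
    [- psi d / |d|^2], and the fixed stepsize satisfies the sufficient decrease
    condition with [rho = 1/2].

    Conclusion.  In both cases each step lowers every component of [F] by at
    least a constant times [(psi d / |d|)^2 >= (|v| / 3)^2].  If [|v|] stayed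
    away from 0, [F] would decrease without bound on the level set, which is
    compact ([liminf_of_sufficient_decrease], [lev_minorant]). *)

Set Implicit Arguments.
Unset Strict Implicit.
Unset Printing Implicit Defensive.

(** * Euclidean geometry of row vectors *)

Lemma dotvC (R : realType) n (u w : 'rV[R]_n) : dotv u w = dotv w u.
Proof. by apply: eq_bigr => i _; rewrite mulrC. Qed.

Lemma dotvDr (R : realType) n (u w z : 'rV[R]_n) :
  dotv u (w + z) = dotv u w + dotv u z.
Proof. by rewrite -big_split; apply: eq_bigr => i _; rewrite mxE mulrDr. Qed.

Lemma dotvZr (R : realType) n (u w : 'rV[R]_n) a :
  dotv u (a *: w) = a * dotv u w.
Proof.
by rewrite /dotv mulr_sumr; apply: eq_bigr => i _; rewrite mxE mulrCA.
Qed.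

Lemma dotvDl (R : realType) n (u w z : 'rV[R]_n) :
  dotv (w + z) u = dotv w u + dotv z u.
Proof. by rewrite !(dotvC _ u) dotvDr. Qed.

Lemma dotvZl (R : realType) n (u w : 'rV[R]_n) a :
  dotv (a *: w) u = a * dotv w u.
Proof. by rewrite !(dotvC _ u) dotvZr. Qed.

Lemma dotvv_ge0 (R : realType) n (u : 'rV[R]_n) : 0 <= dotv u u.
Proof. by apply: sumr_ge0 => i _; rewrite -expr2 sqr_ge0. Qed.

Lemma dotvv_eq0 (R : realType) n (u : 'rV[R]_n) : (dotv u u == 0) = (u == 0).
Proof.
apply/idP/eqP => [|->]; last by apply/eqP/big1 => i _; rewrite mxE mul0r.
rewrite psumr_eq0 => [/allP u0|i _]; last by rewrite -expr2 sqr_ge0.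
apply/rowP => i; rewrite mxE; apply/eqP.
by have := u0 i (mem_index_enum _); rewrite /= mulf_eq0 orbb.
Qed.

Lemma enorm_ge0 (R : realType) n (u : 'rV[R]_n) : 0 <= enorm u.
Proof. exact: sqrtr_ge0. Qed.
#[local] Hint Extern 0 (is_true (_ <= enorm _)) => exact: enorm_ge0 : core.

Lemma enorm_sqr (R : realType) n (u : 'rV[R]_n) : enorm u ^+ 2 = dotv u u.
Proof. exact/sqr_sqrtr/dotvv_ge0. Qed.

Lemma enorm_eq0 (R : realType) n (u : 'rV[R]_n) : (enorm u == 0) = (u == 0).
Proof. by rewrite -dotvv_eq0 -enorm_sqr sqrf_eq0. Qed.

Lemma enorm_gt0 (R : realType) n (u : 'rV[R]_n) : (0 < enorm u) = (u != 0).
Proof. by rewrite lt0r enorm_ge0 andbT enorm_eq0. Qed.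

Lemma enorm0 (R : realType) n : enorm (0 : 'rV[R]_n) = 0.
Proof. by apply/eqP; rewrite enorm_eq0. Qed.

Lemma enormZ (R : realType) n (u : 'rV[R]_n) a :
  enorm (a *: u) = `|a| * enorm u.
Proof.
rewrite /enorm dotvZl dotvZr mulrA -expr2 sqrtrM ?sqr_ge0//.
by rewrite sqrtr_sqr.
Qed.

(** Cauchy-Schwarz: expand [0 <= |(w.w) u - (u.w) w|^2]. *)
Lemma dotv_le_enorm (R : realType) n (u w : 'rV[R]_n) :
  dotv u w <= enorm u * enorm w.
Proof.
have [->|w0] := eqVneq w 0.
  by rewrite enorm0 mulr0 /dotv big1// => i _; rewrite mxE mulr0.
have ww : 0 < dotv w w by rewrite lt0r dotvv_eq0 w0 dotvv_ge0.
apply: le_trans (ler_norm _) _; rewrite -sqrtr_sqr -sqrtrM ?dotvv_ge0//.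
rewrite ler_wsqrtr//.
have := dotvv_ge0 (dotv w w *: u + (- dotv u w) *: w).
rewrite !(dotvDl, dotvDr, dotvZl, dotvZr) (dotvC w u).
set a := dotv w w; set b := dotv u w; set c := dotv u u.
rewrite [leRHS](_ : _ = a * (c * a - b ^+ 2)); last by ring.
by rewrite pmulr_rge0// subr_ge0.
Qed.

Lemma enormD (R : realType) n (u w : 'rV[R]_n) :
  enorm (u + w) <= enorm u + enorm w.
Proof.
rewrite -ler_sqr ?nnegrE ?addr_ge0//.
rewrite sqrrD !enorm_sqr !(dotvDl, dotvDr) (dotvC w u).
have := dotv_le_enorm u w; lra.
Qed.

Lemma enorm_sum (R : realType) n (I : Type) (r : seq I) (f : I -> 'rV[R]_n) :
  enorm (\sum_(i <- r) f i) <= \sum_(i <- r) enorm (f i).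
Proof.
elim/big_ind2: _ => [|u a w b ua wb|//]; first by rewrite enorm0.
exact: le_trans (enormD _ _) (lerD ua wb).
Qed.

(** Euclidean bounds give bounds for the sup norm, to which the library's
    compactness criterion refers. *)
Lemma mx_norm_le_enorm (R : realType) n (u : 'rV[R]_n) : `|u| <= enorm u.
Proof.
rewrite [leLHS]/Num.Def.normr/= mx_normrE; apply: bigmax_le => // -[i j] _ /=.
rewrite ord1 -sqrtr_sqr ler_wsqrtr// /dotv (bigD1 j)//= -expr2 lerDl.
by apply: sumr_ge0 => k _; rewrite -expr2 sqr_ge0.
Qed.

Lemma dotv_continuous (R : realType) n (u : 'rV[R]_n) : continuous (dotv u).
Proof.
rewrite /dotv; apply: continuous_big => [|i _]; first exact: add_continuous.
move=> ?.
by apply: continuousM; [exact: cst_continuous|exact: coord_continuous].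
Qed.

Lemma enorm_continuous (R : realType) n : continuous (@enorm R n).
Proof.
move=> w; apply: continuous_comp; last exact: sqrt_continuous.
move: w; rewrite /dotv.
apply: continuous_big => [|i _]; first exact: add_continuous.
move=> ?.
by apply: continuousM; exact: coord_continuous.
Qed.

(** * Maxima of finite families *)

Lemma le_maxI (R : realType) m (f : 'I_m.+1 -> R) i : f i <= maxI f.
Proof. exact: le_bigmax. Qed.

Lemma maxI_le (R : realType) m (f : 'I_m.+1 -> R) c :
  (forall i, f i <= c) -> maxI f <= c.
Proof. by move=> fc; exact: bigmax_le. Qed.

Lemma maxI_continuous (R : realType) m (T : topologicalType)
    (f : 'I_m.+1 -> T -> R) :
  (forall i, continuous (f i)) -> continuous (fun t => maxI (f^~ t)).
Proof.
move=> fc; rewrite /maxI.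
elim: (index_enum _) => [|i s IH] t.
  by under eq_fun do rewrite big_nil; exact: fc.
under eq_fun do rewrite big_cons.
by apply: continuous_max; [exact: fc|exact: IH].
Qed.

Lemma rownorm_ge0 (R : realType) m n (A : 'M[R]_(m.+1, n)) : 0 <= rownorm A.
Proof.
exact: le_trans (enorm_ge0 _) (le_maxI (fun i => enorm (row i A)) ord0).
Qed.

Lemma row_dotv_le (R : realType) m n (A : 'M[R]_(m.+1, n)) i d :
  dotv (row i A) d <= rownorm A * enorm d.
Proof.
apply: le_trans (dotv_le_enorm _ _) _; rewrite ler_wpM2r//.
exact: (le_maxI (fun i => enorm (row i A))).
Qed.

(** * The support function psi and the steepest descent direction *)

Section psi.
Variables (R : realType) (n m : nat) (F : 'rV[R]_n -> 'rV[R]_m.+1).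
Variable x : 'rV[R]_n.
Implicit Types d : 'rV[R]_n.

Lemma le_psi i d : dotv (row i (jac F x)) d <= psi F x d.
Proof. exact: (le_maxI (fun i => dotv (row i (jac F x)) d)). Qed.

Lemma psi0 : psi F x 0 = 0.
Proof.
rewrite /psi.
have z i : dotv (row i (jac F x)) 0 = 0.
  by rewrite -(scale0r 0) dotvZr mul0r.
apply/eqP; rewrite eq_le; apply/andP; split.
  by apply: maxI_le => i; rewrite z.
by rewrite -(z ord0) le_psi.
Qed.

Lemma psiD d d' : psi F x (d + d') <= psi F x d + psi F x d'.
Proof. by apply: maxI_le => i; rewrite dotvDr lerD// le_psi. Qed.

Lemma psi_sum (I : Type) (r : seq I) (f : I -> 'rV[R]_n) :
  psi F x (\sum_(i <- r) f i) <= \sum_(i <- r) psi F x (f i).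
Proof.
elim/big_ind2: _ => [|u a w b ua wb|//]; first by rewrite psi0.
exact: le_trans (psiD _ _) (lerD ua wb).
Qed.

Lemma psiZ a d : 0 <= a -> psi F x (a *: d) = a * psi F x d.
Proof.
rewrite le_eqVlt => /predU1P[<-|a0]; first by rewrite scale0r mul0r psi0.
apply/eqP; rewrite eq_le; apply/andP; split.
  by apply: maxI_le => i; rewrite dotvZr ler_pM2l// le_psi.
rewrite mulrC -ler_pdivlMr//; apply: maxI_le => i.
by rewrite ler_pdivlMr// mulrC -dotvZr le_psi.
Qed.

Lemma psi_le d : psi F x d <= rownorm (jac F x) * enorm d.
Proof. by apply: maxI_le => i; exact: row_dotv_le. Qed.

Lemma psi_ge d : - (rownorm (jac F x) * enorm d) <= psi F x d.
Proof.
apply: le_trans (le_psi ord0 d); rewrite lerNl.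
rewrite -mulN1r -dotvZr (le_trans (row_dotv_le _ _ _))//.
by rewrite enormZ normrN1 mul1r.
Qed.

Lemma psi_continuous : continuous (psi F x).
Proof. by apply: maxI_continuous => i; exact: dotv_continuous. Qed.

(** Since [psi x d >= - J |d|], the objective is positive, hence larger than
    its value at 0, when [|d| > 2 J]; a minimizer over the compact ball of
    radius [2 J] is therefore a global one. *)
Lemma vdir_min d : steepest_obj F x (vdir F x) <= steepest_obj F x d.
Proof.
move: d; rewrite /vdir.
have sc : continuous (steepest_obj F x).
  move=> u; apply: continuousD; first exact: psi_continuous.
  apply: continuousM; last exact: cst_continuous.
  by apply: continuousM; exact: enorm_continuous.
set J := rownorm (jac F x).
pose K := [set u : 'rV[R]_n | enorm u <= 2 * J].
have K0 : K 0 by rewrite /K /= enorm0 mulr_ge0// rownorm_ge0.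
have cK : compact K.
  apply: bounded_closed_compact.
    exists (2 * J); split; first exact: num_real.
    move=> M JM u /= uK; apply: le_trans (mx_norm_le_enorm u) _.
    exact: le_trans uK (ltW JM).
  have -> : K = (@enorm R n) @^-1` [set r | r <= 2 * J] by [].
  apply: preimage_closed => [u _|]; last exact: closed_le.
  exact: enorm_continuous.
have [||v vK vmin] := @EVT_min_rV R n (steepest_obj F x) K _ cK.
- by exists 0.
- exact: continuous_subspaceT.
apply: (@getPex _ [set u | forall d, steepest_obj F x u <= steepest_obj F x d]).
exists v => d /=.
have [dK|dK] := leP (enorm d) (2 * J); first by apply: vmin; rewrite inE.
apply: (@le_trans _ _ (steepest_obj F x 0)); first by apply: vmin; rewrite inE.
rewrite /steepest_obj psi0 enorm0 expr0n/= mul0r addr0.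
have := psi_ge d; rewrite -/J => psid.
have : J * enorm d <= enorm d ^+ 2 / 2.
  by have := enorm_ge0 d; nra.
lra.
Qed.

(** By homogeneity the objective at [t *: v] is [t psi(v) + t^2 |v|^2 / 2] for
    [t >= 0], and it is minimal at [t = 1], so its derivative there,
    [psi(v) + |v|^2], vanishes. *)
Lemma psi_vdir : psi F x (vdir F x) = - enorm (vdir F x) ^+ 2.
Proof.
set v := vdir F x; set p := psi F x v; set q := enorm v ^+ 2.
have q0 : 0 <= q by rewrite sqr_ge0.
have opt t : 0 <= t -> p + q / 2 <= t * p + t ^+ 2 * q / 2.
  move=> t0; have := vdir_min (t *: v).
  rewrite -/v /steepest_obj psiZ// enormZ ger0_norm// exprMn.
  by rewrite -/p -/q.
have sle : p + q <= q / 2.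
  by have := opt 0 (lexx 0); rewrite expr0n/= !mul0r addr0; lra.
apply/eqP; rewrite -addr_eq0; set s := p + q in sle *.
have opt' e : -1 <= e -> 0 <= e * s + e ^+ 2 * q / 2.
  by move=> e1; have := opt (1 + e); rewrite /s; nra.
move: q0; rewrite le_eqVlt => /predU1P[q0|q0].
  have := opt' 1; have := opt' (- 1); rewrite -q0 eq_le; nra.
have sq : (s / q) * q = s by rewrite divfK ?gt_eqF.
(* [e = - s / q] minimizes [e s + e^2 q / 2], with value [- s^2 / (2 q)]; it is
   at least -1 because [s <= q / 2]. *)
have := opt' (- (s / q)); set z := s / q in sq *; rewrite -sq.
have : - 1 <= - z by nra.
move=> /[swap] /[apply] h; have : z ^+ 2 * q <= 0 by nra.
rewrite pmulr_lle0// => z2.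
by rewrite mulf_eq0 -(sqrf_eq0 z) eq_le sqr_ge0 z2.
Qed.

Lemma enorm_vdir_le : enorm (vdir F x) <= rownorm (jac F x).
Proof.
have [->|v0] := eqVneq (vdir F x) 0; first by rewrite enorm0 rownorm_ge0.
have := psi_ge (vdir F x); rewrite psi_vdir lerN2 expr2.
by rewrite ler_pM2r// enorm_gt0.
Qed.

End psi.

(** * The search direction *)

(** With [S] the weighted sum of the [|p_j|], the hypothesis on the weights and
    the bounds [|psi p_j| <= J |p_j|] give both [- psi d >= J S] and
    [- psi d >= g |v|^2 - J S], while [|v| |d| <= g |v|^2 + J S] because
    [|v| <= J].  The empty [r] covers the first iteration. *)
Lemma direction_angle (R : realType) (n m : nat)
    (F : 'rV[R]_n -> 'rV[R]_m.+1) (x : 'rV[R]_n) (g : R) (I : eqType)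
    (r : seq I) (b : I -> R) (p : I -> 'rV[R]_n) :
  let v := vdir F x in
  let d := g *: v + \sum_(j <- r) b j *: p j in
  0 <= g -> (forall j, j \in r -> 0 <= b j) ->
  \sum_(j <- r) b j * (psi F x (p j) + rownorm (jac F x) * enorm (p j)) <=
    g * enorm v ^+ 2 ->
  g * enorm v ^+ 2 <= 2 * - psi F x d /\
  enorm v * enorm d <= 3 * - psi F x d.
Proof.
move=> v d g0 b0; set J := rownorm _; set q := enorm v ^+ 2.
under eq_bigr do rewrite mulrDr mulrCA.
rewrite big_split -mulr_sumr /=.
set P := \sum_(j <- r) b j * psi F x (p j).
set S := \sum_(j <- r) b j * enorm (p j) => PS.
have S0 : 0 <= S.
  by rewrite /S big_seq; apply: sumr_ge0 => j /b0 bj; rewrite mulr_ge0.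
have PJS : P <= J * S.
  rewrite /P /S mulr_sumr big_seq [leRHS]big_seq; apply: ler_sum => j /b0 bj.
  by rewrite mulrCA ler_wpM2l// psi_le.
have psid : psi F x d <= - (g * q) + P.
  apply: le_trans (psiD _ _ _ _) _; apply: lerD.
    by rewrite psiZ// psi_vdir mulrN.
  apply: le_trans (psi_sum _ _ _ _) _; rewrite /P big_seq [leRHS]big_seq.
  by apply: ler_sum => j /b0 bj; rewrite psiZ.
have dS : enorm d <= g * enorm v + S.
  apply: le_trans (enormD _ _) _; apply: lerD.
    by rewrite enormZ ger0_norm.
  apply: le_trans (enorm_sum _ _) _; rewrite /S big_seq [leRHS]big_seq.
  by apply: ler_sum => j /b0 bj; rewrite enormZ ger0_norm.
have vJS : enorm v * S <= J * S by rewrite ler_wpM2r// enorm_vdir_le.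
have : enorm v * enorm d <= g * q + enorm v * S.
  apply: le_trans (ler_wpM2l (enorm_ge0 v) dS) _.
  by rewrite /q; lra.
by split; lra.
Qed.

(** As [psi] is at least [- J] times the norm, the condition on [phi] makes
    [phi] positive, so the [beta] are nonnegative; multiplying that condition by
    [beta = |v|^2 / (N_k phi)] and summing over the [N_k] terms gives the
    hypothesis of [direction_angle]. *)
Lemma mmg_direction (R : realType) (n m : nat)
    (F : 'rV[R]_n -> 'rV[R]_m.+1) (x0 : 'rV[R]_n) (N : nat)
    (gamma : nat -> R) (beta : nat -> nat -> R) (alpha : nat -> R)
    (x d : nat -> 'rV[R]_n) (k : nat) :
  MMG_scheme F x0 N gamma beta alpha x d -> MMG_params F N gamma beta x d ->
  vdir F (x k) != 0 ->
  psi F (x k) (d k) < 0 /\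
  enorm (vdir F (x k)) * enorm (d k) <= 3 * - psi F (x k) (d k).
Proof.
move=> [N0 g0 _ _ [d0 dS]] [_ [phi phiP]] vN0.
set v := vdir F (x k); set q := enorm v ^+ 2.
have q0 : 0 < q by rewrite exprn_gt0// enorm_gt0.
have gq : 0 < gamma k * q by rewrite mulr_gt0.
suff [h1 h2] : gamma k * q <= 2 * - psi F (x k) (d k) /\
    enorm v * enorm (d k) <= 3 * - psi F (x k) (d k) by split=> //; lra.
case: k => [|k] in v q vN0 q0 gq *.
  rewrite d0 -[_ *: _]addr0.
  have := @direction_angle R n m F (x 0%N) (gamma 0%N) nat [::]
    (fun=> 0) (fun=> 0).
  by rewrite !big_nil; apply => //; exact: ltW.
rewrite dS//; set M := minn k.+1 N.
have M0 : (0 < M)%N by rewrite leq_min.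
set J := rownorm (jac F (x k.+1)).
pose p j := d (k.+1 - j)%N.
have betaP j : j \in index_iota 1 M.+1 -> 0 < phi k.+1 j /\
    [/\ beta k.+1 j = M%:R^-1 * q / phi k.+1 j &
        psi F (x k.+1) (p j) + J * enorm (p j) < gamma k.+1 * phi k.+1 j].
  rewrite mem_index_iota ltnS => jM; have [-> phij] := phiP k.+1 j isT jM.
  have phi0 : 0 < phi k.+1 j.
    apply: le_lt_trans phij; rewrite divr_ge0 ?(ltW (g0 _))//.
    by rewrite -lerBlDr sub0r psi_ge.
  split=> //; split.
    by rewrite psi_vdir -/v -/q mulrNN /recip0 gt_eqF.
  by rewrite [ltRHS]mulrC -ltr_pdivrMr.
apply: (direction_angle (p := p)); first exact: ltW.
  move=> j /betaP[phi0 [-> _]].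
  by rewrite divr_ge0 ?(ltW phi0)// mulr_ge0 ?invr_ge0 ?ler0n ?ltW.
apply: (@le_trans _ _ (\sum_(1 <= j < M.+1) M%:R^-1 * q * gamma k.+1)).
  rewrite big_seq [leRHS]big_seq; apply: ler_sum => j /betaP[phi0 [-> pj]].
  rewrite -[leLHS]mulrA; apply: ler_wpM2l.
    by rewrite mulr_ge0 ?invr_ge0 ?ler0n ?ltW.
  by rewrite ler_pdivrMl// [leRHS]mulrC ltW.
rewrite sumr_const_nat subn1/= -[leLHS]mulr_natl -!mulrA.
rewrite mulVKf ?pnatr_eq0 -?lt0n//.
by rewrite [leRHS]mulrC mulrA.
Qed.

(** * Two facts on real sequences *)

Lemma limn_einf_eq0 (R : realType) (u : nat -> R) :
  (forall k, 0 <= u k) ->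
  (forall e K, 0 < e -> exists2 k, (K <= k)%N & u k < e) ->
  limn_einf (fun k => (u k)%:E) = 0%E.
Proof.
move=> u0 usmall; rewrite limn_einf_lim.
rewrite (_ : einfs _ = cst 0%E) ?lim_cst//; apply/funext => K.
apply/eqP; rewrite eq_le; apply/andP; split.
  apply/lee_addgt0Pr => e e0; rewrite add0e.
  have [k Kk uke] := usmall e K e0.
  apply: (@le_trans _ _ (u k)%:E); last by rewrite lee_fin ltW.
  by apply: ereal_inf_lbound; exists k.
by apply: le_ereal_inf_tmp => _ [k _ <-]; rewrite lee_fin.
Qed.

Lemma unbounded_decrease (R : realType) (f : nat -> R) (e : R) (K : nat) :
  0 < e -> (forall k, (K <= k)%N -> f k.+1 <= f k - e) ->
  forall c, exists k, f k < c.
Proof.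
move=> e0 fe c.
have fK j : f (K + j)%N <= f K - j%:R * e.
  elim: j => [|j IH]; first by rewrite addn0 mul0r subr0.
  rewrite addnS (le_trans (fe _ (leq_addr _ _)))// mulrSr.
  by lra.
set j := Num.bound `|(f K - c) / e|.
exists (K + j)%N; apply: le_lt_trans (fK j) _.
have : (f K - c) / e < j%:R.
  exact: le_lt_trans (ler_norm _) (archi_boundP (normr_ge0 _)).
by rewrite ltr_pdivrMr//; lra.
Qed.

(** * Decrease along a ray *)

Section line_search.
Variables (R : realType) (n m : nat) (F : 'rV[R]_n -> 'rV[R]_m.+1).
Hypothesis F_diff : forall x, differentiable F x.

Lemma is_derive_line (y d : 'rV[R]_n) i (t : R) :
  is_derive t 1 (fun s : R => F (y + s *: d) ord0 i)
    (dotv (row i (jac F (y + t *: d))) d).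
Proof.
have Dline : is_diff t (fun s : R => y + s *: d) (fun s => s *: d).
  apply: is_diff_eq (is_diffD (is_diff_cst y t) (is_diff_scalel t d)) _.
  by apply/funext => s; rewrite /= add0r.
set G := F \o (fun s : R => y + s *: d).
have DG : is_diff t G ('d F (y + t *: d) \o (fun s => s *: d)).
  by apply: is_diff_comp; exact: differentiableP.
have dG : differentiable G t by exact: ex_diff.
apply: DeriveDef.
  apply/derivable1_diffP.
  exact: (differentiable_comp dG (differentiable_coord (G t) ord0 i)).
transitivity (('D_1 G t) ord0 i).
  by rewrite derive_mx ?mxE//; exact/derivable1_diffP.
rewrite deriveE// diff_val /= scale1r -deriveE// deriveEjacobian// mxE.
by apply: eq_bigr => j _; rewrite !mxE mulrC.
Qed.

Variables (L : R) (B : set 'rV[R]_n).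
Hypotheses (L_ge0 : 0 <= L) (B_open : open B) (JF_lip : jac_lipschitz_on F L B).

(** The mean value theorem uses derivatives on the open interval only, so the
    end point of the segment need not lie in [B]; this is what makes the
    first-exit argument of [sufficient_decrease_short] work. *)
Lemma line_increment (y d : 'rV[R]_n) i (t : R) : B y -> 0 < t ->
  (forall s, 0 < s < t -> B (y + s *: d)) ->
  F (y + t *: d) ord0 i <=
    F y ord0 i + t * (psi F y d + L * t * enorm d ^+ 2).
Proof.
move=> By t0 Bs; pose g s := F (y + s *: d) ord0 i.
have [|s st gs] := @MVT R g (fun s => dotv (row i (jac F (y + s *: d))) d)
  0 t t0 (fun s _ => is_derive_line y d i s).
  apply: continuous_subspaceT => s.
  exact/differentiable_continuous/derivable1_diffP/ex_derive/is_derive_line.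
have {st}[s0 st] : 0 < s /\ s < t by move: st; rewrite in_itv => /andP.
move: gs; rewrite /g scale0r addr0 subr0 => /eqP.
rewrite subr_eq => /eqP ->; rewrite addrC lerD2l mulrC ler_pM2l//.
set z := y + s *: d.
have -> : jac F z = jac F y + (jac F z - jac F y) by rewrite addrC subrK.
rewrite linearD dotvDl lerD ?le_psi//.
apply: le_trans (row_dotv_le _ _ _) _; rewrite expr2 mulrA ler_wpM2r//.
apply: le_trans (JF_lip _ By) _; first by apply: Bs; rewrite s0.
rewrite -mulrA ler_wpM2l// /z addrAC subrr add0r enormZ gtr0_norm//.
by rewrite ler_wpM2r// ltW.
Qed.

Variable (x0 : 'rV[R]_n).
Hypothesis lev_sub_B : lev F x0 `<=` B.

Lemma sufficient_decrease_lev rho y d t :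
  0 <= rho -> 0 <= t -> psi F y d <= 0 -> lev F x0 y ->
  sufficient_decrease F rho y d t -> lev F x0 (y + t *: d).
Proof.
move=> rho0 t0 psid ylev sd i; apply: le_trans (sd i) (le_trans _ (ylev i)).
by rewrite gerDl mulr_ge0_le0// mulr_ge0.
Qed.

(** [line_increment] yields the decrease as soon as the segment stays in [B].
    If the segment left [B], let [e] be its first exit parameter: the part
    before [e] lies in [B] and gives sufficient decrease at [e], so the exit
    point lies in the level set, hence in [B], a contradiction. *)
Lemma sufficient_decrease_short rho y d t :
  0 <= rho -> lev F x0 y -> psi F y d <= 0 -> 0 <= t ->
  t * (L * enorm d ^+ 2) <= (1 - rho) * - psi F y d ->
  sufficient_decrease F rho y d t.
Proof.
move=> rho0 ylev psid t0 tle.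
have By : B y by exact: lev_sub_B.
have step u : 0 <= u <= t -> (forall s, 0 < s < u -> B (y + s *: d)) ->
    sufficient_decrease F rho y d u.
  move=> /andP[]; rewrite le_eqVlt => /predU1P[<- _ _ i|u0 ut Bs i].
    by rewrite scale0r addr0 mulr0 mul0r addr0.
  apply: le_trans (line_increment i By u0 Bs) _.
  rewrite lerD2l [rho * u]mulrC -[leRHS]mulrA ler_pM2l//.
  have : u * (L * enorm d ^+ 2) <= t * (L * enorm d ^+ 2).
    by rewrite ler_wpM2r// mulr_ge0 ?sqr_ge0.
  by rewrite [L * u]mulrC -[u * L * _]mulrA; lra.
apply: (step t); first by rewrite t0 lexx.
move=> s /andP[s0 st]; apply: contrapT => nBs.
(* [Z] collects the parameters at which the ray is outside [B]. *)
pose Z := `[0, t]%classic `&` (fun r : R => y + r *: d) @^-1` (~` B).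
have Zcpt : compact Z.
  apply: (subclosed_compact _ (@segment_compact _ 0 t)) => [|r []//].
  apply: closedI; first exact: interval_closed.
  apply: preimage_closed; last by apply: open_closedC.
  move=> r _; apply: cvgD; first exact: cvg_cst.
  exact: scalel_continuous.
have Zs : Z s by split=> //=; rewrite in_itv/= !ltW.
have [|e] := compact_EVT_min (ex_intro _ s Zs) Zcpt (f := @id R).
  by apply: continuous_subspaceT => r; exact: cvg_id.
rewrite inE => -[/= et nBe] emin; apply: nBe; apply: lev_sub_B.
have {et}/andP[e0 et] : 0 <= e <= t by move: et; rewrite in_itv.
apply: (sufficient_decrease_lev rho0 e0 psid ylev); apply: step.
  by rewrite e0.
move=> r /andP[r0 re]; apply: contrapT => nBr.
have : e <= r.
  apply: emin; rewrite inE; split => //=.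
  by rewrite in_itv/= (ltW r0) (le_trans (ltW re)).
by rewrite leNgt re.
Qed.


(** Trial steps up to [(1 - rho) / L] times [- psi d / |d|^2] are accepted, and
    the stepsize is the largest accepted one.  The factor [delta ^+ j] does not
    depend on the iterate. *)
Lemma line_search_lower_bound rho delta y d a j :
  0 < rho < 1 -> 0 < delta < 1 -> lev F x0 y -> psi F y d < 0 ->
  stepsize_I F rho delta y d a -> delta ^+ j * L <= 1 - rho ->
  delta ^+ j * (- psi F y d / enorm d ^+ 2) <= a.
Proof.
move=> /andP[rho0 rho1] /andP[delta0 delta1] ylev psid [_ amax] jL.
have d0 : d != 0 by apply: contraTneq psid => ->; rewrite psi0 ltxx.
have q0 : 0 < enorm d ^+ 2 by rewrite exprn_gt0// enorm_gt0.
apply: amax; split; first by exists j.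
apply: sufficient_decrease_short => //; first exact: ltW.
- exact: ltW.
- rewrite mulr_ge0 ?exprn_ge0 ?(ltW delta0)//.
  by rewrite divr_ge0 ?(ltW q0)// oppr_ge0 ltW.
rewrite [X in X <= _](_ : _ = delta ^+ j * L * - psi F y d).
  by rewrite ler_pM2r// oppr_gt0.
by field; rewrite enorm_eq0.
Qed.

(** The level set is closed and bounded, hence compact. *)
Lemma lev_minorant i : ebounded (lev F x0) ->
  exists c : R, forall y, lev F x0 y -> c <= F y ord0 i.
Proof.
move=> [M levM].
have Fi_cont j : continuous (fun y => F y ord0 j).
  move=> y; apply: (@continuous_comp _ _ _ F (fun w => w ord0 j)).
    exact/differentiable_continuous.
  exact: coord_continuous.
have lev_cpt : compact (lev F x0).
  apply: bounded_closed_compact.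
    exists M; split; first exact: num_real.
    move=> M' MM' y /= ylev; apply: le_trans (mx_norm_le_enorm y) _.
    exact: le_trans (levM y ylev) (ltW MM').
  have -> : lev F x0 =
      \bigcap_(j in setT)
        ((fun y => F y ord0 j) @^-1` [set r | r <= F x0 ord0 j]).
    by apply/seteqP; split=> [y ylev j _|y ylev j]; exact: ylev.
  apply: closed_bigI => j _.
  by apply: preimage_closed => [y _|]; [exact: Fi_cont|exact: closed_le].
have [||c _ cmin] := @EVT_min_rV R n (fun y => F y ord0 i) (lev F x0) _ lev_cpt.
- by exists x0 => j.
- exact/continuous_subspaceT/Fi_cont.
by exists (F c ord0 i) => y ylev; apply: cmin; rewrite inE.
Qed.
End line_search.

(** * Convergence *)

(** If [|v_k| >= e] from some index on, the angle condition gives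
    [- psi d_k / |d_k| >= e / 3], so each step lowers the first component of [F]
    by [rho kappa (e / 3)^2], which contradicts the lower bound [c]. *)
Lemma liminf_of_sufficient_decrease (R : realType) (n m : nat)
    (F : 'rV[R]_n -> 'rV[R]_m.+1) (rho kappa c : R)
    (x d v : nat -> 'rV[R]_n) (alpha : nat -> R) :
  0 < rho -> 0 < kappa ->
  (forall k, x k.+1 = x k + alpha k *: d k) ->
  (forall k, psi F (x k) (d k) < 0) ->
  (forall k, enorm (v k) * enorm (d k) <= 3 * - psi F (x k) (d k)) ->
  (forall k, sufficient_decrease F rho (x k) (d k) (alpha k)) ->
  (forall k, kappa * (- psi F (x k) (d k) / enorm (d k) ^+ 2) <= alpha k) ->
  (forall k, c <= F (x k) ord0 ord0) ->
  limn_einf (fun k => (enorm (v k))%:E) = 0%E.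
Proof.
move=> rho0 kappa0 xS psid angle sd alphaP cF.
apply: limn_einf_eq0 => // e K e0; apply: contrapT => no_small.
have vge k : (K <= k)%N -> e <= enorm (v k).
  by move=> Kk; rewrite leNgt; apply/negP => vk; apply: no_small; exists k.
have eps0 : 0 < rho * kappa * (e / 3) ^+ 2.
  by rewrite !mulr_gt0// exprn_gt0// divr_gt0.
have [|k] := unbounded_decrease (f := fun k => F (x k) ord0 ord0) (K := K)
  eps0 _ c.
  move=> k Kk; rewrite xS; apply: le_trans (sd k ord0) _; rewrite lerD2l.
  have d0 : 0 < enorm (d k).
    rewrite enorm_gt0; apply: contraTneq (psid k) => ->.
    by rewrite psi0 ltxx.
  set p := - psi F (x k) (d k); set nd := enorm (d k) in d0.
  have p0 : 0 < p by rewrite oppr_gt0.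
  have -> : psi F (x k) (d k) = - p by rewrite opprK.
  have ratio : e / 3 <= p / nd.
    rewrite ler_pdivlMr//; have := angle k; rewrite -/p -/nd.
    have : e * nd <= enorm (v k) * nd by rewrite ler_pM2r// vge.
    by lra.
  have sq : (e / 3) ^+ 2 <= (p / nd) ^+ 2.
    by rewrite ler_sqr ?nnegrE ?divr_ge0// ltW.
  rewrite mulrN lerN2 -!mulrA ler_pM2l//.
  apply: le_trans (_ : kappa * (p / nd ^+ 2) * p <= _); last first.
    by rewrite ler_pM2r// alphaP.
  rewrite -mulrA ler_pM2l// (le_trans sq)// expr_div_n expr2.
  by rewrite mulrAC.
by rewrite ltNge cF.
Qed.

Unset Implicit Arguments.

Theorem theorem4p1 (R : realType) (n m : nat)
  (F : 'rV[R]_n -> 'rV[R]_m.+1) (x0 : 'rV[R]_n)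
  (B : set 'rV[R]_n) (L : R) (x d : nat -> 'rV[R]_n)
  (F_C1 : cont_diff F)
  (L_gt0 : 0 < L)
  (B_open : open B)
  (lev_sub_B : lev F x0 `<=` B)
  (JF_lip : jac_lipschitz_on F L B)
  (lev_bounded : ebounded (lev F x0))
  (generated : MMG_I F x0 x d \/ MMG_II F L x0 x d)
  (v_neq0 : forall k, vdir F (x k) <> 0) :
  limn_einf (fun k => (enorm (vdir F (x k)))%:E) = 0%E.
Proof.
have F_diff := F_C1.1.
have v_neq0' k : vdir F (x k) != 0 by apply/eqP.
have [c cF] := lev_minorant F_diff ord0 lev_bounded.
have L_ge0 := ltW L_gt0.
have lev_iter rho (alpha : nat -> R) : 0 <= rho ->
    x 0%N = x0 -> (forall k, 0 < alpha k) ->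
    (forall k, x k.+1 = x k + alpha k *: d k) ->
    (forall k, psi F (x k) (d k) < 0) ->
    (forall k, lev F x0 (x k) ->
       sufficient_decrease F rho (x k) (d k) (alpha k)) ->
    forall k, lev F x0 (x k).
  move=> rho0 x00 a0 xS psid sd; elim=> [|k IH]; first by rewrite x00.
  rewrite xS; apply: (sufficient_decrease_lev rho0 (ltW (a0 k))) => //.
    exact: ltW.
  exact: sd.
case: generated => [[N [gamma [beta [alpha [rho [delta]]]]]]
                   |[N [gamma [beta [alpha]]]]].
  move=> [sch par rho01 delta01 stp].
  have [_ _ a0 [x00 xS] _] := sch.
  have dir k := mmg_direction sch par (v_neq0' k).
  have [rho0 rho1] := andP rho01; have [delta0 delta1] := andP delta01.
  have sd k : sufficient_decrease F rho (x k) (d k) (alpha k).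
    by have [[]] := stp k.
  have levx := lev_iter rho alpha (ltW rho0) x00 a0 xS (fun k => (dir k).1)
    (fun k _ => sd k).
  (* [delta ^+ j] is the uniform factor in front of [- psi d / |d|^2]. *)
  have [j jL] : exists j, delta ^+ j * L <= 1 - rho.
    have delta_norm : `|delta| < 1 by rewrite gtr0_norm.
    have /cvgrPdist_le/(_ ((1 - rho) / L)) := cvg_expr delta_norm.
    rewrite divr_gt0 ?subr_gt0// => /(_ isT).
    move=> [j _ /(_ j (leqnn j))]; rewrite sub0r normrN.
    rewrite ger0_norm ?exprn_ge0 ?(ltW delta0)//.
    by rewrite ler_pdivlMr// => ?; exists j.
  apply: (liminf_of_sufficient_decrease rho0 (exprn_gt0 j delta0) xS) => // k.
  - exact: (dir k).1.
  - exact: (dir k).2.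
  - exact: (line_search_lower_bound F_diff L_ge0 B_open JF_lip lev_sub_B rho01
      delta01 (levx k) (dir k).1 (stp k) jL).
  - exact: cF.
move=> [sch par stp].
have [_ _ a0 [x00 xS] _] := sch.
have dir k := mmg_direction sch par (v_neq0' k).
have half0 : 0 < 2^-1 :> R by rewrite invr_gt0.
have d0 k : enorm (d k) != 0.
  rewrite enorm_eq0; apply: contraTneq (dir k).1 => ->.
  by rewrite psi0 ltxx.
(* The fixed stepsize is the longest step allowed by
   [sufficient_decrease_short] with [rho = 1/2]. *)
have sd k : lev F x0 (x k) -> sufficient_decrease F 2^-1 (x k) (d k) (alpha k).
  move=> levk.
  apply: (sufficient_decrease_short F_diff L_ge0 B_open JF_lip lev_sub_B) => //.
  - exact: ltW (dir k).1.
  - exact: ltW.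
  rewrite stp [leLHS](_ : _ = (1 - 2^-1) * - psi F (x k) (d k))//.
  by field; rewrite d0 gt_eqF.
have levx := lev_iter 2^-1 alpha (ltW half0) x00 a0 xS (fun k => (dir k).1) sd.
have kappa0 : 0 < (2 * L)^-1 by rewrite invr_gt0 mulr_gt0.
apply: (liminf_of_sufficient_decrease half0 kappa0 xS) => // k.
- exact: (dir k).1.
- exact: (dir k).2.
- exact/sd/levx.
- rewrite stp le_eqVlt; apply/orP; left; apply/eqP.
  by field; rewrite d0 gt_eqF.
- exact: cF.
Qed.
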